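(* Consider the logistic loss $\ell(y,u)=yu+\log(1+e^{-u})$ for $y\in\{0,1\}$, $u\in\mathbb{R}$. Assume that $(X_i,Y_i)_{i=1,\dots,n}$ are iid satisfying the logistic regression model $$\mathbb{P}(Y_i=1\mid X_i)=1-\mathbb{P}(Y_i=0\mid X_i)=\frac{1}{1+\exp(X_i^\top\beta^* )}$$ for some $\beta^*\in\mathbb{R}^p$ with $\|\Sigma^{1/2}\beta^*\|\le 1$, and that $X_1,\dots,X_n$ are mean zero and $L$-subGaussian with respect to their covariance $\Sigma$. Then, with $B=1/(6\sqrt3)$, $B_2=1$ and an absolute constant $B_3>0$, one has for all $u_1\ne u_2\in\mathbb{R}$ and all $y$ $$\frac{|\ell''(y,u_1)-\ell''(y,u_2)|}{|u_1-u_2|}\le B,\qquad |\ell''(y,u_1)|\le B_2,\qquad \sup_{u\in\mathbb{R}^p,\,u\neq0}\frac{\|\Sigma^{1/2}u\|^2}{\|K^{1/2}u\|^2}\le B_3 ,$$ where $K=\frac1n\sum_{i=1}^n\mathbb{E}[\ell''(Y_i,X_i^\top\beta^* )X_iX_i^\top]$. (The constant $1$ in $\|\Sigma^{1/2}\beta^*\|\le1$ can be replaced by another absolute constant; this only changes $B_3$ to a different constant.)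
   Context: $\|\cdot\|$ is the Euclidean norm and $\ell''(y,u)$ is the second partial derivative of $\ell$ in $u$. The covariance $\Sigma$ is positive definite. A random vector $X\in\mathbb{R}^p$ is $L$-subGaussian with respect to $\Sigma$ if $\mathbb{E}[\exp(u^\top X)]\le\exp(L^2\|\Sigma^{1/2}u\|^2/2)$ for all $u\in\mathbb{R}^p$.
   Formalization: The constant B_3 is allowed to depend on the subGaussian parameter L (and on the bound replacing 1 in ‖Σ^{1/2}β*‖≤1); a B_3 independent of L does not exist, as X=0 w.p. 1-ε and ±ε^{-1/2} w.p. ε/2 each, with p=1, β*=1, shows. *)

(* Defs.v *)
From HB Require Import structures.
From mathcomp Require Import all_boot all_order all_algebra.
From mathcomp Require Import all_classical all_reals all_analysis.

Set Implicit Arguments.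
Unset Strict Implicit.
Unset Printing Implicit Defensive.

Import Order.TTheory GRing.Theory Num.Theory.
Import numFieldNormedType.Exports.

Local Open Scope classical_set_scope.
Local Open Scope ring_scope.

(* 'M[R]_(m, n) carries its Borel sigma-algebra. *)
Section matrix_borel.
Context (R : realType) (m n : nat).
Let G : set (set 'M[R]_(m, n)) := [set A | open A].

HB.instance Definition _ := @isMeasurable.Build (sigma_display G)
  'M[R]_(m, n) <<s G >>
  (@sigma_algebra0 _ setT G) (@sigma_algebraC _ G)
  (@sigma_algebra_bigcup _ setT G).
End matrix_borel.

Section linear_algebra.
Context (R : realType) (p : nat).

Definition dotv (u v : 'cV[R]_p) : R := (u^T *m v) 0 0.

(* The library norm on matrices is the sup norm, hence this definition. *)
Definition enorm (u : 'cV[R]_p) : R := Num.sqrt (dotv u u).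

Definition psdmx (A : 'M[R]_p) : Prop :=
  A^T = A /\ forall u, 0 <= dotv u (A *m u).

Definition pdmx (A : 'M[R]_p) : Prop :=
  A^T = A /\ forall u, u != 0 -> 0 < dotv u (A *m u).

(* A positive semidefinite matrix has exactly one positive semidefinite square
   root; the default value 0 is only taken for other matrices. *)
Definition sqrtmx (A : 'M[R]_p) : 'M[R]_p :=
  xget 0 [set S | psdmx S /\ S *m S = A].

End linear_algebra.

Section probability_notions.
Context (R : realType) (d : measure_display) (T : measurableType d)
  (P : probability T R).

Definition mutually_independent (d' : measure_display)
    (U : measurableType d') (n : nat) (Z : 'I_n -> T -> U) : Prop :=
  forall (J : {set 'I_n}) (A : 'I_n -> set U), (forall i, measurable (A i)) ->
    P (\bigcap_(i in [set` J]) (Z i @^-1` A i)) =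
    (\prod_(i in J) P (Z i @^-1` A i))%E.

Definition identically_distributed (d' : measure_display)
    (U : measurableType d') (n : nat) (Z : 'I_n -> T -> U) : Prop :=
  forall (i j : 'I_n) (A : set U), measurable A ->
    P (Z i @^-1` A) = P (Z j @^-1` A).

Definition iid (d' : measure_display) (U : measurableType d') (n : nat)
    (Z : 'I_n -> T -> U) : Prop :=
  mutually_independent Z /\ identically_distributed Z.

(* g(X) is a version of the conditional probability P(E | X). *)
Definition is_cond_prob (d' : measure_display) (U : measurableType d')
    (E : set T) (X : T -> U) (g : U -> R) : Prop :=
  measurable_fun setT g /\
  forall A : set U, measurable A ->
    P (E `&` (X @^-1` A)) = (\int[P]_(t in X @^-1` A) (g (X t))%:E)%E.

Section random_vectors.
Context (p : nat).
Implicit Types (X : T -> 'cV[R]_p) (Sigma : 'M[R]_p).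

Definition mean_zero X : Prop :=
  forall j, ('E_P[fun t => (X t j 0)%R] = 0)%E.

Definition has_covariance X Sigma : Prop :=
  forall j k,
    covariance P (fun t => X t j 0) (fun t => X t k 0) = (Sigma j k)%:E.

Definition subGaussian (L : R) Sigma X : Prop :=
  forall u : 'cV[R]_p,
    ('E_P[fun t => expR (dotv u (X t))] <=
       (expR (L ^+ 2 * enorm (sqrtmx Sigma *m u) ^+ 2 / 2)%R)%:E)%E.

End random_vectors.

Definition expectation_mx (m k : nat) (M : T -> 'M[R]_(m, k)) : 'M[R]_(m, k) :=
  \matrix_(i, j) fine ('E_P[fun t => M t i j])%E.

End probability_notions.

Section logistic.
Context (R : realType).

(* The labels 0 and 1 are the booleans false and true. *)
Definition logistic_loss (y : bool) (u : R) : R :=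
  y%:R * u + ln (1 + expR (- u)).

Definition logistic_loss'' (y : bool) : R -> R := ((logistic_loss y)^`(2))%classic.

Definition logistic_model (d : measure_display) (T : measurableType d)
    (P : probability T R) (p : nat) (beta : 'cV[R]_p)
    (X : T -> 'cV[R]_p) (Y : T -> bool) : Prop :=
  let eta (x : 'cV[R]_p) := 1 / (1 + expR (dotv x beta)) in
  is_cond_prob P (Y @^-1` [set true]) X eta /\
  is_cond_prob P (Y @^-1` [set false]) X (fun x => 1 - eta x).

Definition logistic_K (d : measure_display) (T : measurableType d)
    (P : probability T R) (n p : nat) (beta : 'cV[R]_p)
    (X : 'I_n -> T -> 'cV[R]_p) (Y : 'I_n -> T -> bool) : 'M[R]_p :=
  n%:R^-1 *: \sum_(i < n) expectation_mx P (fun t =>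
    logistic_loss'' (Y i t) (dotv (X i t) beta) *: (X i t *m (X i t)^T)).

End logistic.

(* The supremum of |Sigma^(1/2) u|^2 / |K^(1/2) u|^2 over u != 0. The quotient
   is taken in \bar R, where x / 0 = +oo for x > 0, so that a finite bound
   forces K^(1/2) u != 0 when Sigma is positive definite. *)
Definition sup_quad_ratio (R : realType) (p : nat) (Sigma K : 'M[R]_p) : \bar R :=
  ereal_sup [set ((enorm (sqrtmx Sigma *m u) ^+ 2)%R%:E /
                  (enorm (sqrtmx K *m u) ^+ 2)%R%:E)%E | u in [set u | u != 0]].

(* Main.v *)
Require Import Defs.
From HB Require Import structures.
From mathcomp Require Import all_boot all_order all_algebra.
From mathcomp Require Import all_classical all_reals all_analysis.
From mathcomp Require Import measurable_realfun ring lra.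
From mathcomp Require Import complex.

Set Implicit Arguments.
Unset Strict Implicit.
Unset Printing Implicit Defensive.

Import Order.TTheory GRing.Theory Num.Theory.
Import numFieldNormedType.Exports.

Local Open Scope classical_set_scope.
Local Open Scope ring_scope.

(** The logistic curvature does not depend on the label: l''(y, u) = 1 / g(u)
    with g(u) = exp(u) + 2 + exp(-u). Writing s = 1 / (1 + exp(u)), it equals
    s (1 - s), so it lies in (0, 1], and its derivative is (2 s - 1) s (1 - s).
    With t = |2 s - 1| the latter has modulus t (1 - t^2) / 4, whose maximum
    over [0, 1] is 1 / (6 sqrt 3), attained at t = 1 / sqrt 3; the mean value
    theorem turns this into the Lipschitz bound.

    For the third bound, the square roots are first eliminated: a positive
    semidefinite real matrix has a positive semidefinite square root
    ([psdmx_sqrt]), hence |A^(1/2) u|^2 = u^T A u ([enorm_sqrtmx]). The claim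
    becomes u^T Sigma u <= C u^T K u, and K is an average of the matrices
    E[X_i X_i^T / g(X_i^T beta)], so it is enough to treat one sample vector
    X. By homogeneity take u^T Sigma u = 1, and put a = u^T X, b = beta^T X, so
    that E[a^2] = 1. The convex function x |-> 1 / x lies above its tangent at
    C, which gives a^2 / g(b) >= (2 / C) a^2 - a^2 g(b) / C^2. The
    elementary inequality
      a^2 g(b) <= 12 (exp a + exp(-a)) + 4 (exp(2 b) + exp(-2 b))
    and the subGaussian bounds on the exponential moments show that
    E[a^2 g(b)] <= C for C = 24 exp(L^2 / 2) + 8 exp(2 L^2 c^2). Hence
    E[a^2 / g(b)] >= 2 / C - 1 / C = 1 / C ([curvature_moment_unit]). *)

(** * The logistic loss *)

Section logistic_curvature.
Variable R : realType.
Implicit Types (u : R) (y : bool).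

(** The probability 1 / (1 + exp u) of the label 1 when X^T beta = u. *)
Definition logistic_prob u : R := (1 + expR u)^-1.

Let den_gt0 u : 0 < 1 + expR u.
Proof. by rewrite addr_gt0 ?expR_gt0. Qed.

Lemma logistic_prob_gt0 u : 0 < logistic_prob u.
Proof. by rewrite invr_gt0. Qed.

Lemma logistic_prob_lt1 u : logistic_prob u < 1.
Proof. by rewrite invf_lt1// ltrDl expR_gt0. Qed.

Lemma is_derive_logistic_prob u :
  is_derive u 1 logistic_prob (- (logistic_prob u * (1 - logistic_prob u))).
Proof.
have dden : is_derive u (1 : R) (fun v : R => 1 + expR v) (expR u).
  have -> : (fun v : R => 1 + expR v) = cst 1 + expR by [].
  by apply: is_derive_eq; rewrite add0r.
have := @is_deriveV _ _ u _ 1 (lt0r_neq0 (den_gt0 u)) dden.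
rewrite /logistic_prob => h; apply: (is_derive_eq h).
have := lt0r_neq0 (den_gt0 u).
rewrite /GRing.scale/= => ?; field.
by [].
Qed.

Lemma is_derive_logistic_loss y u :
  is_derive u 1 (logistic_loss y) (y%:R - logistic_prob u).
Proof.
have dexp : is_derive u (1 : R) (fun v : R => 1 + expR (- v)) (- expR (- u)).
  have -> : (fun v : R => 1 + expR (- v)) = cst 1 + (expR \o -%R) by [].
  by apply: is_derive_eq; rewrite add0r mulrN1.
have dln := @is_derive1_comp _ _ _ u _ _ (is_derive1_ln (den_gt0 (- u))) dexp.
have -> : logistic_loss y =
    (y%:R : R) \*: (id : R -> R) + (@ln R \o (fun v => 1 + expR (- v))).
  by apply/funext.
apply: is_derive_eq; rewrite /GRing.scale/= /logistic_prob mulr1 expRN.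
have := lt0r_neq0 (den_gt0 u); have := lt0r_neq0 (expR_gt0 u) => ? ?.
field.
by rewrite addrC; apply/andP.
Qed.

Lemma logistic_loss''E y u :
  logistic_loss'' y u = logistic_prob u * (1 - logistic_prob u).
Proof.
rewrite /logistic_loss''/=.
have -> : (logistic_loss y)^`()%classic = cst (y%:R) - logistic_prob.
  apply/funext => v; rewrite derive1E.
  exact: (@derive_val _ _ _ _ _ _ _ (is_derive_logistic_loss y v)).
rewrite derive1E.
have dp := is_derive_logistic_prob u.
by rewrite derive_val sub0r opprK.
Qed.

(** The common value of l''(0, u) and l''(1, u), in a form that shows how fast
    it decays. *)
Definition curvature u : R := (expR u + 2 + expR (- u))^-1.

Lemma logistic_loss''_curvature y u : logistic_loss'' y u = curvature u.
Proof.
rewrite logistic_loss''E /logistic_prob /curvature expRN.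
have := lt0r_neq0 (den_gt0 u); have e0 := expR_gt0 u => ?.
have ? := lt0r_neq0 e0.
by field; rewrite -?andbA; apply/and3P; split => //; apply: lt0r_neq0.
Qed.

Lemma logistic_loss''_gt0 y u : 0 < logistic_loss'' y u.
Proof.
by rewrite logistic_loss''E mulr_gt0 ?logistic_prob_gt0// subr_gt0 logistic_prob_lt1.
Qed.

Lemma logistic_loss''_le1 y u : `|logistic_loss'' y u| <= 1.
Proof.
rewrite ger0_norm ?ltW ?logistic_loss''_gt0// logistic_loss''E.
have := logistic_prob_gt0 u; have := logistic_prob_lt1 u.
by set s := logistic_prob u => ? ?; nra.
Qed.

Lemma is_derive_logistic_loss'' y u :
  is_derive u 1 (logistic_loss'' y)
    ((2 * logistic_prob u - 1) * (logistic_prob u * (1 - logistic_prob u))).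
Proof.
have -> : logistic_loss'' y = logistic_prob * (cst 1 - logistic_prob).
  by apply/funext => v; rewrite logistic_loss''E.
have dp := is_derive_logistic_prob u.
by apply: is_derive_eq; rewrite /GRing.scale/= !fctE; ring.
Qed.

(** The right-hand side is the maximum of the left-hand side over [0, 1]. *)
Lemma centered_variance_le (s : R) : 0 <= s -> s <= 1 ->
  `|(2 * s - 1) * (s * (1 - s))| <= 1 / (6 * Num.sqrt 3).
Proof.
set r := Num.sqrt 3 => s0 s1.
have r0 : 0 < r by rewrite sqrtr_gt0.
have r2 : r ^+ 2 = 3 by rewrite sqr_sqrtr.
(* Both sides are invariant under s |-> 1 - s. *)
wlog : s s0 s1 / 1 <= 2 * s => [hw|hs].
  have [|h] := lerP 1 (2 * s); first exact: hw.
  have -> : (2 * s - 1) * (s * (1 - s)) =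
    - ((2 * (1 - s) - 1) * ((1 - s) * (1 - (1 - s)))) by ring.
  by rewrite normrN; apply: hw; lra.
set t := 2 * s - 1.
have t0 : 0 <= t by rewrite /t; lra.
have -> : (2 * s - 1) * (s * (1 - s)) = t * (1 - t ^+ 2) / 4 by rewrite /t; field.
have t1 : t <= 1 by rewrite /t; lra.
have t2 : 0 <= 1 - t ^+ 2 by nra.
rewrite ger0_norm ?divr_ge0 ?mulr_ge0//.
rewrite ler_pdivlMr ?mulr_gt0//.
(* The gap to the maximum factors, with a double root at t = 1 / r. *)
have : 0 <= (r * t - 1) ^+ 2 * (r * t + 2).
  by rewrite mulr_ge0 ?sqr_ge0// addr_ge0// mulr_ge0// ltW.
have -> : (r * t - 1) ^+ 2 * (r * t + 2) = r ^+ 2 * r * t ^+ 3 - 3 * r * t + 2 by ring.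
by rewrite r2; lra.
Qed.

Lemma logistic_loss''_lipschitz y u1 u2 : u1 != u2 ->
  `|logistic_loss'' y u1 - logistic_loss'' y u2| / `|u1 - u2|
    <= 1 / (6 * Num.sqrt 3).
Proof.
wlog u12 : u1 u2 / u1 < u2 => [hw|_].
  move=> /[dup] u12; rewrite neq_lt => /orP[|u21]; first by move/hw; apply.
  by rewrite distrC [`|u1 - u2|]distrC; apply: hw => //; rewrite eq_sym.
have cf : {within `[u1, u2], continuous (logistic_loss'' y)}.
  apply: derivable_within_continuous => x _.
  exact: (@ex_derive _ _ _ _ _ _ _ (is_derive_logistic_loss'' y x)).
have [c _] := MVT u12 (fun x _ => is_derive_logistic_loss'' y x) cf.
rewrite distrC [`|u1 - u2|]distrC => ->.
rewrite normrM mulfK ?normr_eq0 ?subr_eq0 ?gt_eqF//.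
by apply: centered_variance_le; rewrite ltW ?logistic_prob_gt0 ?logistic_prob_lt1.
Qed.

Lemma curvature_itv u : 0 <= curvature u <= 1.
Proof.
rewrite -(logistic_loss''_curvature true) ltW ?logistic_loss''_gt0//=.
by rewrite (le_trans (ler_norm _))// logistic_loss''_le1.
Qed.

Lemma measurable_curvature : measurable_fun setT curvature.
Proof.
have -> : curvature = logistic_loss'' true.
  by apply/funext => u; rewrite logistic_loss''_curvature.
apply: continuous_measurable_fun => u; apply: differentiable_continuous.
apply/derivable1_diffP.
exact: (@ex_derive _ _ _ _ _ _ _ (is_derive_logistic_loss'' true u)).
Qed.

End logistic_curvature.

(** * Quadratic forms *)

Section quadratic_forms.
Variables (R : realType) (p : nat).

Lemma dotv_sum (u v : 'cV[R]_p) : dotv u v = \sum_i u i 0 * v i 0.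
Proof. by rewrite /dotv mxE; apply: eq_bigr => i _; rewrite mxE. Qed.

Lemma dotvC (u v : 'cV[R]_p) : dotv u v = dotv v u.
Proof. by rewrite !dotv_sum; apply: eq_bigr => i _; rewrite mulrC. Qed.

Lemma dotvvE (u : 'cV[R]_p) : dotv u u = \sum_i u i 0 ^+ 2.
Proof. by rewrite dotv_sum; apply: eq_bigr => i _; rewrite expr2. Qed.

Lemma dotvv_ge0 (u : 'cV[R]_p) : 0 <= dotv u u.
Proof. by rewrite dotvvE sumr_ge0// => i _; rewrite sqr_ge0. Qed.

Lemma dotvv_gt0 (u : 'cV[R]_p) : u != 0 -> 0 < dotv u u.
Proof.
move=> u0; rewrite lt0r dotvv_ge0 andbT; apply: contra u0.
rewrite dotvvE psumr_eq0 => [/allP h|i _]; last exact: sqr_ge0.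
apply/eqP/matrixP => i j; rewrite ord1 mxE.
by have /h := mem_index_enum i; rewrite sqrf_eq0 => /eqP.
Qed.

Lemma dotvNl (u v : 'cV[R]_p) : dotv (- u) v = - dotv u v.
Proof. by rewrite /dotv linearN/= mulNmx mxE. Qed.

Lemma dotvZl k (u v : 'cV[R]_p) : dotv (k *: u) v = k * dotv u v.
Proof. by rewrite /dotv linearZ/= -scalemxAl mxE. Qed.

Lemma quadformZ k (M : 'M[R]_p) (u : 'cV[R]_p) :
  dotv (k *: u) (M *m (k *: u)) = k ^+ 2 * dotv u (M *m u).
Proof. by rewrite dotvZl -scalemxAr /dotv -scalemxAr mxE mulrA. Qed.

Lemma quadform_average (n : nat) (k : R)
  (M : 'I_n -> 'M[R]_p) (u : 'cV[R]_p) :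
  dotv u ((k *: \sum_i M i) *m u) = k * \sum_i dotv u (M i *m u).
Proof.
by rewrite /dotv -scalemxAl -scalemxAr mxE mulmx_suml mulmx_sumr summxE.
Qed.

Lemma psdmx_average (n : nat) (k : R) (M : 'I_n -> 'M[R]_p) :
  0 <= k -> (forall i, psdmx (M i)) -> psdmx (k *: \sum_i M i).
Proof.
move=> k0 psdM; split=> [|u].
  rewrite linearZ/= linear_sum/=; congr (_ *: _).
  by apply: eq_bigr => i _; exact: (psdM i).1.
rewrite quadform_average mulr_ge0// sumr_ge0// => i _.
exact: (psdM i).2.
Qed.

End quadratic_forms.

(** * Square roots of positive semidefinite matrices *)

Lemma poly_interpolation (F : fieldType) (f : F -> F) (s : seq F) :
  exists q : {poly F}, {in s, forall x, q.[x] = f x}.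
Proof.
elim: s => [|x s [q qs]]; first by exists 0.
have [xs|xs] := boolP (x \in s).
  by exists q => z; rewrite inE => /predU1P[->|]; apply: qs.
pose w : {poly F} := \prod_(z <- s) ('X - z%:P).
have wx : w.[x] != 0 by rewrite -[_ == 0]/(root w x) root_prod_XsubC.
exists (q + ((f x - q.[x]) / w.[x]) *: w) => z; rewrite inE !hornerE.
move=> /predU1P[->|zs]; first by rewrite divfK// addrC subrK.
have /eqP -> : root w z by rewrite root_prod_XsubC.
by rewrite mulr0 addr0 qs.
Qed.

Lemma trmx_horner_mx (R : comNzRingType) (n : nat) (A : 'M[R]_n.+1)
  (q : {poly R}) : (horner_mx A q)^T = horner_mx A^T q.
Proof.
elim/poly_ind: q => [|q a IH]; first by rewrite !rmorph0 trmx0.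
rewrite !rmorphD !rmorphM /= !horner_mx_C !horner_mx_X linearD/=.
rewrite -mulmxE trmx_mul IH tr_scalar_mx; congr (_ + _).
have /comm_mx_horner : GRing.comm A^T A^T by [].
by move=> /(_ q) ->.
Qed.

(** A real symmetric matrix is killed by every polynomial that vanishes at its
    eigenvalues, because it is diagonalizable over the complex numbers with
    real eigenvalues. This form of the spectral theorem speaks of real
    matrices only. *)
Lemma symmetric_annihilating_roots (R : rcfType) (n : nat) (A : 'M[R]_n.+1) :
  A^T = A ->
  exists2 s : seq R, {in s, forall x, eigenvalue A x} &
    forall q : {poly R}, {in s, forall x, q.[x] = 0} -> horner_mx A q = 0.
Proof.
move=> symA; pose toC := real_complex R; pose AC := map_mx toC A.
have hermA : AC \is hermsymmx.
  apply: realsym_hermsym.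
    by apply/is_hermitianmxP; rewrite expr0 scale1r map_mx_id// map_trmx symA.
  by apply/mxOverP => i j; rewrite mxE /toC complex_real.
pose U := spectralmx AC; pose d := spectral_diag AC.
have AE : AC = invmx U *m diag_mx d *m U.
  by apply/orthomx_spectralP/hermitian_normalmx.
have Uu : U \in unitmx := spectral_unit AC.
have dE j : d 0 j = toC (complex.Re (d 0 j)).
  rewrite /toC RRe_real//.
  exact: (mxOverP (hermitian_spectral_diag_real hermA)).
exists [seq complex.Re (d 0 j) | j <- enum 'I_n.+1].
  move=> _ /mapP[j _ ->]; rewrite eigenvalue_root_char.
  (* The characteristic polynomial has real coefficients, so an eigenvalue of
     AC that is real is an eigenvalue of A. *)
  rewrite -(fmorph_root (real_complex R)) map_char_poly.
  rewrite -[map_mx _ A]/AC -[X in root _ X]/(toC _) -dE -eigenvalue_root_char.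
  apply/eigenvalueP; exists (row j U).
    rewrite -row_mul AE !mulmxA mulmxV// mul1mx.
    by rewrite row_mul row_diag_mx -scalemxAl -rowE.
  (* The rows of an invertible matrix do not vanish. *)
  move: Uu; rewrite -row_free_unit => /row_freeP[V UV]; apply/eqP => U0.
  have /eqP := congr1 (fun M => row j M 0 j) UV.
  by rewrite row_mul U0 mul0mx !mxE eqxx eq_sym oner_eq0.
move=> q qs; apply: (@map_mx_inj _ _ toC).
rewrite map_mx0 map_horner_mx -[map_mx _ A]/AC AE.
rewrite (horner_mx_uconjC _ _ Uu) horner_mx_diag.
suff -> : map_mx (horner (map_poly toC q)) d = 0 by rewrite raddf0 mulmx0 mul0mx.
apply/matrixP => i j; rewrite ord1 !mxE dE horner_map qs ?rmorph0//.
by apply/mapP; exists j; rewrite ?mem_enum.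
Qed.

Lemma psdmx_eigenvalue_ge0 (R : realType) (p : nat) (A : 'M[R]_p) (x : R) :
  psdmx A -> eigenvalue A x -> 0 <= x.
Proof.
move=> [symA posA] /eigenvalueP[v vA v0].
have w0 : v^T != 0 by rewrite trmx_eq0.
have := posA v^T; rewrite -{1}symA -trmx_mul vA linearZ/= /dotv.
by rewrite -scalemxAr mxE pmulr_lge0//; apply: (dotvv_gt0 w0).
Qed.

(** The square root is a polynomial in A. *)
Lemma psdmx_sqrt (R : realType) (p : nat) (A : 'M[R]_p) :
  psdmx A -> exists S : 'M[R]_p, psdmx S /\ S *m S = A.
Proof.
case: p A => [|n] A psdA.
  by exists A; split; [exact: psdA|rewrite [LHS]flatmx0 [RHS]flatmx0].
have [s spec ann] := symmetric_annihilating_roots psdA.1.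
(* Interpolating the fourth root makes the square root of A the square of the
   symmetric matrix Q, hence positive semidefinite. *)
have [q qs] := poly_interpolation (fun x => Num.sqrt (Num.sqrt x)) s.
pose Q := horner_mx A q.
have symQ : Q^T = Q by rewrite trmx_horner_mx psdA.1.
exists (Q *m Q); split; first split.
- by rewrite trmx_mul symQ.
- move=> u; have := dotvv_ge0 (Q *m u).
  by rewrite /dotv trmx_mul symQ !mulmxA.
- apply/eqP; rewrite -subr_eq0 -[X in _ - X]horner_mx_X mulmxE -!rmorphM -rmorphB.
  apply/eqP/ann => x xs; rewrite !hornerD hornerN hornerX !hornerM qs// -!expr2.
  have x0 := psdmx_eigenvalue_ge0 psdA (spec x xs).
  by rewrite !sqr_sqrtr ?sqrtr_ge0// subrr.
Qed.

Lemma enorm_sqrtmx (R : realType) (p : nat) (A : 'M[R]_p) (u : 'cV[R]_p) :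
  psdmx A -> enorm (sqrtmx A *m u) ^+ 2 = dotv u (A *m u).
Proof.
move=> psdA; rewrite /enorm sqr_sqrtr ?dotvv_ge0//.
have [[symS _] SS] : psdmx (sqrtmx A) /\ sqrtmx A *m sqrtmx A = A.
  rewrite /sqrtmx; case: xgetP => [S _ //|noS].
  by have [S /noS] := psdmx_sqrt psdA.
by rewrite /dotv trmx_mul symS mulmxA -(mulmxA _ (sqrtmx A) (sqrtmx A)) SS mulmxA.
Qed.

(** * Elementary inequalities *)

Lemma pow4_le_expR (R : realType) (a : R) :
  a ^+ 4 <= 24 * (expR a + expR (- a)).
Proof.
wlog a0 : a / 0 <= a => [hw|].
  have [/hw//|/ltW a0] := lerP 0 a.
  have := hw (- a); rewrite oppr_ge0 => /(_ a0).
  by rewrite opprK addrC; have -> : (- a) ^+ 4 = a ^+ 4 by ring.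
have := expR_ge1Dxn 3 a0; have := expR_gt0 (- a).
have -> : (4`!)%:R = 24 :> R by [].
by lra.
Qed.

(** A bound on a^2 g(b) by functions of a and of b alone, each of which has a
    finite expectation for subGaussian a and b. *)
Lemma curvature_weight_bound (R : realType) (a b : R) :
  a ^+ 2 * (expR b + 2 + expR (- b)) <=
    12 * (expR a + expR (- a)) + 4 * (expR (2 * b) + expR (- (2 * b))).
Proof.
have := pow4_le_expR a; set A := expR a + _ => ha.
rewrite -mulrN !expRM_natl.
have : expR b * expR (- b) = 1 by rewrite -expRD subrr expR0.
have := expR_gt0 b; have := expR_gt0 (- b).
set x := expR b; set y := expR (- b) => x0 y0 xy.
(* 2 a^2 (x + 2 + y) is at most the sum of the squares of the two factors. *)
have h1 : a ^+ 2 * (x + 2 + y) <= (a ^+ 4 + (x + 2 + y) ^+ 2) / 2.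
  have := sqr_ge0 (a ^+ 2 - (x + 2 + y)).
  have -> : (a ^+ 2 - (x + 2 + y)) ^+ 2 = a ^+ 4 + (x + 2 + y) ^+ 2
    - 2 * (a ^+ 2 * (x + 2 + y)) by ring.
  by lra.
have h2 : (x + 2 + y) ^+ 2 <= 8 * (x ^+ 2 + y ^+ 2).
  have s2 : 2 <= x + y.
    have xy0 : 0 <= x + y by rewrite ltW ?addr_gt0.
    rewrite -(@ler_pXn2r _ 2) ?nnegrE//.
    have -> : (x + y) ^+ 2 = (x - y) ^+ 2 + 4 * (x * y) by ring.
    by have := sqr_ge0 (x - y); rewrite xy; lra.
  have -> : x ^+ 2 + y ^+ 2 = (x + y) ^+ 2 - 2 * (x * y) by ring.
  rewrite xy mulr1.
  have : 0 <= (x + y - 2) * (7 * (x + y) + 10) by rewrite mulr_ge0//; lra.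
  have -> : (x + y - 2) * (7 * (x + y) + 10) =
    8 * ((x + y) ^+ 2 - 2) - (x + 2 + y) ^+ 2 by ring.
  by rewrite subr_ge0.
by lra.
Qed.

(** For s > 0 the left-hand side is the tangent to x |-> x^-1 at s^-1. *)
Lemma tangent_le_inv (R : realType) (x s : R) :
  0 < x -> 2 * s - s ^+ 2 * x <= x^-1.
Proof.
move=> x0; rewrite -[x^-1]mul1r ler_pdivlMr//.
by have := sqr_ge0 (s * x - 1); lra.
Qed.

(** * Integrability and measurability *)

Section square_integrals.
Context (R : realType) (d : measure_display) (T : measurableType d)
  (P : probability T R).

Local Notation integrableR f := (P.-integrable setT (EFin \o f)).

Lemma integrable_RD (f g : T -> R) :
  integrableR f -> integrableR g -> integrableR (fun t => f t + g t).
Proof. by move=> f1 g1; exact: (integrableD measurableT f1 g1). Qed.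

Lemma integrable_RZ (k : R) (f : T -> R) :
  integrableR f -> integrableR (fun t => k * f t).
Proof. by move=> f1; exact: (integrableZl measurableT k f1). Qed.

Lemma le_integrable_R (f g : T -> R) : measurable_fun setT f ->
  (forall t, `|f t| <= g t) -> integrableR g -> integrableR f.
Proof.
move=> mf fg; apply: le_integrable => //; first exact/measurable_EFinP.
by move=> t _; rewrite /= lee_fin (le_trans (fg t))// ler_norm.
Qed.

Lemma integrable_Rsum (I : Type) (s : seq I) (h : I -> T -> R) :
  (forall i, integrableR (h i)) ->
  integrableR (fun t => \sum_(i <- s) h i t).
Proof.
move=> ih.
apply: eq_integrable
  (@integrable_sum _ _ _ _ _ measurableT _ s predT _ (fun i _ => ih i)) => //.
by move=> t _; rewrite /= sumEFin.
Qed.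

Lemma Rintegral_sum (I : Type) (s : seq I) (h : I -> T -> R) :
  (forall i, integrableR (h i)) ->
  \int[P]_t (\sum_(i <- s) h i t) = \sum_(i <- s) \int[P]_t h i t.
Proof.
move=> ih; elim: s => [|i s IH].
  rewrite big_nil; under eq_Rintegral do rewrite big_nil.
  by rewrite Rintegral_cst// mul0r.
rewrite big_cons; under eq_Rintegral do rewrite big_cons.
by rewrite RintegralD ?IH//; exact: integrable_Rsum.
Qed.

Variables (p : nat) (X : {mfun T >-> 'cV[R]_p}).

Lemma measurable_coord (j : 'I_p) : measurable_fun setT (fun t => X t j 0).
Proof.
have mc : measurable_fun setT (fun x : 'cV[R]_p => x j 0).
  move=> mD; apply: (measurability _ (RGenOpens.measurableE R)) => //.
  move=> _ [_ [a [b ->] <-]]; rewrite setTI; apply: sub_sigma_algebra => /=.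
  by apply: open_comp; [move=> + _; exact: coord_continuous|exact: interval_open].
exact: measurableT_comp mc (@measurable_funPT _ _ _ _ X).
Qed.

Lemma measurable_dotv (u : 'cV[R]_p) : measurable_fun setT (fun t => dotv u (X t)).
Proof.
under eq_fun do rewrite dotv_sum.
by apply: measurable_sum => j; apply: measurable_funM => //; exact: measurable_coord.
Qed.

End square_integrals.

(** * Moments of a subGaussian vector *)

Section subgaussian_moments.
Context (R : realType) (d : measure_display) (T : measurableType d)
  (P : probability T R) (p : nat) (X : {mfun T >-> 'cV[R]_p}).

Local Notation integrableR f := (P.-integrable setT (EFin \o f)).

Variables (L : R) (Sigma : 'M[R]_p).
Hypothesis psdS : psdmx Sigma.
Hypothesis sgX : subGaussian P L Sigma X.

Lemma subGaussian_exp_moment (u : 'cV[R]_p) :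
  integrableR (fun t => expR (dotv u (X t))) /\
  \int[P]_t expR (dotv u (X t)) <= expR (L ^+ 2 * dotv u (Sigma *m u) / 2).
Proof.
have := sgX u; rewrite enorm_sqrtmx// unlock => h.
have i1 : integrableR (fun t => expR (dotv u (X t))).
  apply/integrableP; split.
    by apply/measurable_EFinP; apply: measurableT_comp => //; exact: measurable_dotv.
  rewrite (le_lt_trans _ (ltry (expR (L ^+ 2 * dotv u (Sigma *m u) / 2))))//.
  under eq_integral do rewrite /= ger0_norm ?expR_ge0//.
  exact: h.
split=> //; rewrite -lee_fin fineK//.
exact: integrable_fin_num.
Qed.

Lemma subGaussian_cosh_moment (u : 'cV[R]_p) :
  let f t := expR (dotv u (X t)) + expR (- dotv u (X t)) in
  integrableR f /\
  \int[P]_t f t <= 2 * expR (L ^+ 2 * dotv u (Sigma *m u) / 2).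
Proof.
have [i1 l1] := subGaussian_exp_moment u.
have := subGaussian_exp_moment (- u).
have -> : (fun t => expR (dotv (- u) (X t))) = (fun t => expR (- dotv u (X t))).
  by apply/funext => t; rewrite dotvNl.
have := quadformZ (- 1) Sigma u; rewrite scaleN1r sqrrN expr1n mul1r => qN.
rewrite qN => -[i2 l2]; split; first exact: integrable_RD.
by rewrite RintegralD// mulr_natl mulr2n lerD.
Qed.

Lemma integrable_sqr_dotv (u : 'cV[R]_p) :
  integrableR (fun t => dotv u (X t) ^+ 2).
Proof.
have [i1 _] := subGaussian_cosh_moment u.
have [i0 _] := subGaussian_cosh_moment 0.
apply: le_integrable_R (integrable_RD (integrable_RZ 12 i1) (integrable_RZ 4 i0)).
  by apply: measurable_funX; exact: measurable_dotv.
move=> t; rewrite ger0_norm ?sqr_ge0//.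
(* At b = 0 the factor a^2 g(b) is 4 a^2. *)
have := curvature_weight_bound (dotv u (X t)) 0.
have -> : dotv 0 (X t) = 0 by rewrite /dotv trmx0 mul0mx mxE.
rewrite mulr0 oppr0 expR0.
have := sqr_ge0 (dotv u (X t)); lra.
Qed.

(** The matrix E[w X X^T], for a random weight w. *)
Definition weighted_moment_mx (w : T -> R) : 'M[R]_p :=
  \matrix_(j, k) \int[P]_t (w t * (X t j 0 * X t k 0)).

Section weight.
Variable w : T -> R.
Hypothesis mw : measurable_fun setT w.
Hypothesis w01 : forall t, 0 <= w t <= 1.

Lemma integrable_weighted_coord (j k : 'I_p) :
  integrableR (fun t => w t * (X t j 0 * X t k 0)).
Proof.
have cE l t : X t l 0 = dotv (delta_mx l 0) (X t).
  by rewrite /dotv trmx_delta -rowE mxE.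
apply: le_integrable_R (integrable_RD (integrable_sqr_dotv (delta_mx j 0))
                                      (integrable_sqr_dotv (delta_mx k 0))).
  apply: measurable_funM => //.
  by apply: measurable_funM; exact: measurable_coord.
move=> t; rewrite -!cE; have /andP[w0 w1] := w01 t.
rewrite normrM ger0_norm//.
apply: (@le_trans _ _ `|X t j 0 * X t k 0|).
  by rewrite ler_piMl.
set x := X t j 0; set y := X t k 0.
by rewrite ler_norml; apply/andP; split; nra.
Qed.

Lemma weighted_quadform (u : 'cV[R]_p) :
  dotv u (weighted_moment_mx w *m u) =
  \int[P]_t (w t * dotv u (X t) ^+ 2).
Proof.
have -> : (fun t => w t * dotv u (X t) ^+ 2) =
  (fun t => \sum_j \sum_k (u j 0 * u k 0) * (w t * (X t j 0 * X t k 0))).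
  apply/funext => t; rewrite dotv_sum.
  rewrite expr2 mulr_suml mulr_sumr; apply: eq_bigr => j _.
  rewrite mulr_sumr mulr_sumr; apply: eq_bigr => k _.
  by ring.
have ic j k := integrable_weighted_coord j k.
rewrite Rintegral_sum => [|j]; last first.
  by apply: integrable_Rsum => k; apply: integrable_RZ.
rewrite /dotv mxE; apply: eq_bigr => j _.
rewrite Rintegral_sum => [|k]; last exact: integrable_RZ.
rewrite !mxE mulr_sumr; apply: eq_bigr => k _.
by rewrite RintegralZl// !mxE; ring.
Qed.

Lemma integrable_weighted_sqr (u : 'cV[R]_p) :
  integrableR (fun t => w t * dotv u (X t) ^+ 2).
Proof.
apply: le_integrable_R (integrable_sqr_dotv u).
  by apply: measurable_funM => //; apply: measurable_funX; exact: measurable_dotv.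
move=> t; have /andP[w0 w1] := w01 t.
by rewrite normrM ger0_norm// (ger0_norm (sqr_ge0 _)) ler_piMl ?sqr_ge0.
Qed.

Lemma psdmx_weighted_moment : psdmx (weighted_moment_mx w).
Proof.
split=> [|u].
  apply/matrixP => j k; rewrite !mxE.
  by apply: eq_Rintegral => t _; rewrite [X in _ * X]mulrC.
rewrite weighted_quadform; apply: Rintegral_ge0 => t _.
by have /andP[w0 _] := w01 t; rewrite mulr_ge0 ?sqr_ge0.
Qed.

End weight.

Lemma covariance_moment_mx : mean_zero P X -> has_covariance P X Sigma ->
  Sigma = weighted_moment_mx (cst 1).
Proof.
move=> m0 cov; apply/matrixP => j k; rewrite !mxE.
apply: EFin_inj; rewrite -(cov j k) covariance.unlock !m0 /=.
rewrite expectation.unlock fineK; last first.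
  apply: integrable_fin_num => //; apply: integrable_weighted_coord => // t.
  by rewrite ler01 lexx.
by apply: eq_integral => t _; rewrite /= !fctE/= !subr0 mul1r.
Qed.

End subgaussian_moments.

(** * The lower bound on the curvature *)

Section curvature_lower_bound.
Context (R : realType).

(** The constant C that bounds the quotient of u^T Sigma u by u^T K u. *)
Definition condition_bound (L c : R) : R :=
  24 * expR (L ^+ 2 / 2) + 8 * expR (2 * L ^+ 2 * c ^+ 2).

Lemma condition_bound_gt0 (L c : R) : 0 < condition_bound L c.
Proof. by rewrite addr_gt0// mulr_gt0// expR_gt0. Qed.

Context (d : measure_display) (T : measurableType d)
  (P : probability T R) (p : nat) (X : {mfun T >-> 'cV[R]_p}).
Variables (L c : R) (Sigma : 'M[R]_p) (beta : 'cV[R]_p).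
Hypothesis psdS : psdmx Sigma.
Hypothesis sgX : subGaussian P L Sigma X.
Hypothesis mX : mean_zero P X.
Hypothesis covX : has_covariance P X Sigma.
Hypothesis normb : enorm (sqrtmx Sigma *m beta) <= c.

(** The matrix E[l''(X^T beta) X X^T], the contribution of one sample to K. *)
Definition curvature_moment_mx : 'M[R]_p :=
  weighted_moment_mx P X (fun t => curvature (dotv beta (X t))).

Lemma measurable_curvature_dotv :
  measurable_fun setT (fun t => curvature (dotv beta (X t))).
Proof.
by apply: measurableT_comp; [exact: measurable_curvature|exact: measurable_dotv].
Qed.

Lemma psdmx_curvature_moment : psdmx curvature_moment_mx.
Proof.
apply: (psdmx_weighted_moment psdS sgX) => [|t].
  exact: measurable_curvature_dotv.
exact: curvature_itv.
Qed.

(** The lower bound 1 / C for v^T K v on the ellipsoid v^T Sigma v = 1, K being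
    the contribution of one sample. *)
Lemma curvature_moment_unit (v : 'cV[R]_p) : dotv v (Sigma *m v) = 1 ->
  (condition_bound L c)^-1 <= dotv v (curvature_moment_mx *m v).
Proof.
move=> v1; set C := condition_bound L c.
have C0 : 0 < C := condition_bound_gt0 L c.
have mw := measurable_curvature_dotv.
have w01 t := curvature_itv (dotv beta (X t)).
rewrite (weighted_quadform psdS sgX)//.
have [iv lv] := subGaussian_cosh_moment psdS sgX v.
have [ib lb] := subGaussian_cosh_moment psdS sgX (2 *: beta).
set fv := fun t => _ in iv lv; set fb := fun t => _ in ib lb.
have i2 := integrable_sqr_dotv psdS sgX v.
have vX1 : \int[P]_t (dotv v (X t) ^+ 2) = 1.
  rewrite -v1 (covariance_moment_mx psdS sgX mX covX).
  rewrite (weighted_quadform psdS sgX)//; last by move=> t; rewrite ler01 lexx.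
  by apply: eq_Rintegral => t _; rewrite mul1r.
(* H t dominates a^2 g(b) and has expectation at most C. *)
pose H t := 12 * fv t + 4 * fb t.
have i12 := integrable_RZ 12 iv; have i4 := integrable_RZ 4 ib.
have iH : P.-integrable setT (EFin \o H) := integrable_RD i12 i4.
have HC : \int[P]_t H t <= C.
  rewrite RintegralD// !RintegralZl//.
  rewrite v1 mulr1 in lv.
  have hb : expR (L ^+ 2 * dotv (2 *: beta) (Sigma *m (2 *: beta)) / 2)
      <= expR (2 * L ^+ 2 * c ^+ 2).
    rewrite ler_expR quadformZ -enorm_sqrtmx//.
    have : enorm (sqrtmx Sigma *m beta) ^+ 2 <= c ^+ 2.
      by rewrite ler_sqr ?nnegrE ?sqrtr_ge0// (le_trans _ normb) ?sqrtr_ge0.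
    move: (enorm _ ^+ 2) => e ec.
    have -> : L ^+ 2 * (2 ^+ 2 * e) / 2 = 2 * L ^+ 2 * e by field.
    by rewrite ler_wpM2l// mulr_ge0// sqr_ge0.
  have {}lb := le_trans lb (ler_wpM2l (ler0n R 2) hb).
  rewrite (le_trans (lerD (ler_wpM2l (ler0n R 12) lv) (ler_wpM2l (ler0n R 4) lb)))//.
  by rewrite /C /condition_bound !mulrA -!natrM.
(* The tangent at C corresponds to s = 1 / C, which maximizes the final lower
   bound 2 s - s^2 C. *)
have lowi : P.-integrable setT (EFin \o
    (fun t => 2 * C^-1 * dotv v (X t) ^+ 2 + - C^-1 ^+ 2 * H t)).
  exact: integrable_RD (integrable_RZ _ i2) (integrable_RZ _ iH).
have : \int[P]_t (2 * C^-1 * dotv v (X t) ^+ 2 + - C^-1 ^+ 2 * H t) <=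
    \int[P]_t (curvature (dotv beta (X t)) * dotv v (X t) ^+ 2).
  apply: le_Rintegral => //; first exact: (integrable_weighted_sqr psdS sgX).
  move=> t _; set a := dotv v (X t); set b := dotv beta (X t).
  have g0 : 0 < expR b + 2 + expR (- b) by rewrite !addr_gt0 ?expR_gt0.
  have h1 := ler_wpM2r (sqr_ge0 a) (tangent_le_inv C^-1 g0).
  have h2 : a ^+ 2 * (expR b + 2 + expR (- b)) <= H t.
    by have := curvature_weight_bound a b; rewrite /H /fv /fb dotvZl.
  have h3 := ler_wpM2l (sqr_ge0 C^-1) h2.
  rewrite mulNr.
  rewrite (le_trans _ h1)// mulrBl lerD2l lerN2.
  by rewrite -[X in X <= _]mulrA [_ * a ^+ 2]mulrC.
apply: le_trans.
rewrite RintegralD//; [|exact: integrable_RZ..].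
rewrite !RintegralZl// vX1 mulr1 mulNr lerBrDr mulr_natl mulr2n lerD2l.
rewrite (le_trans (ler_wpM2l (sqr_ge0 C^-1) HC))//.
by rewrite expr2 mulfVK ?lt0r_neq0.
Qed.

Lemma curvature_moment_ge (u : 'cV[R]_p) :
  dotv u (Sigma *m u) <= condition_bound L c * dotv u (curvature_moment_mx *m u).
Proof.
have C0 := condition_bound_gt0 L c.
have := psdS.2 u; rewrite le_eqVlt => /predU1P[<-|q0].
  exact: mulr_ge0 (ltW C0) (psdmx_curvature_moment.2 u).
set q := dotv u _ in q0 *.
have sq0 : 0 < Num.sqrt q by rewrite sqrtr_gt0.
have k2 : (Num.sqrt q)^-1 ^+ 2 = q^-1 by rewrite exprVn sqr_sqrtr// ltW.
have := @curvature_moment_unit ((Num.sqrt q)^-1 *: u).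
rewrite !quadformZ k2 -/q mulVf ?lt0r_neq0// => /(_ erefl).
by rewrite ler_pdivlMl// ler_pdivrMr// mulrC.
Qed.

End curvature_lower_bound.

(** * Bounds for the logistic model *)

Lemma logistic_KE (R : realType) (d : measure_display) (T : measurableType d)
  (P : probability T R) (n p : nat) (beta : 'cV[R]_p)
  (X : 'I_n -> {mfun T >-> 'cV[R]_p}) (Y : 'I_n -> {mfun T >-> bool}) :
  logistic_K P beta X Y =
  n%:R^-1 *: \sum_(i < n) curvature_moment_mx P (X i) beta.
Proof.
congr (_ *: _); apply: eq_bigr => i _; apply/matrixP => j k; rewrite !mxE.
rewrite expectation.unlock; apply: eq_Rintegral => t _.
by rewrite !mxE big_ord1 !mxE logistic_loss''_curvature dotvC.
Qed.

Theorem proposition2p2 (R : realType) (L c : R) :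
  exists B3 : R, 0 < B3 /\
  forall (n p : nat) (d : measure_display) (T : measurableType d)
    (P : probability T R) (Sigma : 'M[R]_p) (beta : 'cV[R]_p)
    (X : 'I_n -> {mfun T >-> 'cV[R]_p}) (Y : 'I_n -> {mfun T >-> bool}),
  (0 < n)%N ->
  pdmx Sigma ->
  iid P (fun i t => (X i t, Y i t)) ->
  (forall i, logistic_model P beta (X i) (Y i)) ->
  enorm (sqrtmx Sigma *m beta) <= c ->
  (forall i, mean_zero P (X i)) ->
  (forall i, has_covariance P (X i) Sigma) ->
  (forall i, subGaussian P L Sigma (X i)) ->
  [/\ forall (y : bool) (u1 u2 : R), u1 != u2 ->
        `|logistic_loss'' y u1 - logistic_loss'' y u2| / `|u1 - u2|
          <= 1 / (6 * Num.sqrt 3),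
      forall (y : bool) (u : R), `|logistic_loss'' y u| <= 1 &
      (sup_quad_ratio Sigma (logistic_K P beta X Y) <= B3%:E)%E].
Proof.
exists (condition_bound L c); split; first exact: condition_bound_gt0.
move=> n p d T P Sigma beta X Y n0 [symS posS] _ _ normb mX covX sgX.
split; [exact: logistic_loss''_lipschitz|exact: logistic_loss''_le1|].
have psdS : psdmx Sigma.
  split=> // u; have [->|/posS/ltW//] := eqVneq u 0.
  by rewrite mulmx0 dotvv_ge0.
have n0R : 0 < n%:R :> R by rewrite ltr0n.
have C0 := condition_bound_gt0 L c.
apply: ge_ereal_sup => _ [u /= u0 <-]; rewrite logistic_KE.
rewrite !enorm_sqrtmx//; last first.
  apply: psdmx_average => [|i]; first by rewrite invr_ge0 ltW.
  exact: psdmx_curvature_moment psdS (sgX i).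
rewrite quadform_average.
have qpos := posS u u0; set q := dotv u _ in qpos *; set D := n%:R^-1 * _.
have qD : q <= condition_bound L c * D.
  have : \sum_(i < n) q <= \sum_(i < n) (condition_bound L c *
      dotv u (curvature_moment_mx P (X i) beta *m u)).
    apply: ler_sum => i _.
    exact: curvature_moment_ge psdS (sgX i) (mX i) (covX i) normb u.
  by rewrite sumr_const card_ord -mulr_natl -mulr_sumr /D mulrCA ler_pdivlMl.
have D0 : 0 < D by rewrite -(pmulr_rgt0 _ C0) (lt_le_trans qpos).
by rewrite inver gt_eqF// -EFinM lee_fin ler_pdivrMr.
Qed.
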